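(* Let $A$ be a dilation on $\mathbb{R}^n$ and $\theta>0$. Suppose $\alpha(\cdot)\in L^\infty(\mathbb{R}^n)$ is a real-valued function which is log-H\''older continuous at the origin and at infinity, $q(\cdot)\in\mathcal{P}(\mathbb{R}^n)$, $1<p<\infty$, and $0\le\lambda<\infty$. If $f,g\in M\dot{K}^{\alpha(\cdot),\lambda,\theta}_{q(\cdot),p)}(A;\mathbb{R}^n)$, then $f+g\in M\dot{K}^{\alpha(\cdot),\lambda,\theta}_{q(\cdot),p)}(A;\mathbb{R}^n)$ and $$\|f+g\|_{M\dot{K}^{\alpha(\cdot),\lambda,\theta}_{q(\cdot),p)}(A;\mathbb{R}^n)}\le\|f\|_{M\dot{K}^{\alpha(\cdot),\lambda,\theta}_{q(\cdot),p)}(A;\mathbb{R}^n)}+\|g\|_{M\dot{K}^{\alpha(\cdot),\lambda,\theta}_{q(\cdot),p)}(A;\mathbb{R}^n)}.$$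
   Context: Dilations. A dilation is a real $n\times n$ matrix $A$ all of whose eigenvalues $\lambda$ satisfy $|\lambda|>1$; $b=|\det A|$. Fix an ellipsoid $\Delta=\{x\in\mathbb{R}^n:|Px|<1\}$ ($P$ a nondegenerate $n\times n$ matrix) with $|\Delta|=1$ and a number $r>1$ such that $\Delta\subset r\Delta\subset A\Delta$. For $k\in\mathbb{Z}$ put $B_k=A^k\Delta$ (so $|B_k|=b^k$ and $B_k\subset rB_k\subset B_{k+1}$), $C_k=B_k\setminus B_{k-1}$, $\chi_k=\chi_{C_k}$. Variable exponents. $\mathcal{P}(\mathbb{R}^n)$ is the set of measurable $q(\cdot):\mathbb{R}^n\to[1,\infty)$ with $q^-=\operatorname{ess\,inf} q>1$ and $q^+=\operatorname{ess\,sup}q<\infty$. The norm is $\|f\|_{L^{q(\cdot)}(\mathbb{R}^n)}=\inf\{\lambda>0:\int_{\mathbb{R}^n}(|f(x)|/\lambda)^{q(x)}dx\le1\}$. $L^{q(\cdot)}_{\rm loc}(\Omega)$ is the set of $f$ with $f\in L^{q(\cdot)}(E)$ for all compact $E\subset\Omega$. A function $g:\mathbb{R}^n\to\mathbb{R}$ is log-H\''older continuous at the origin if there is $C>0$ with $|g(x)-g(0)|\le C/\log(e+1/|x|)$ for all $x$, and log-H\''older continuous at infinity if there are $g_\infty\in\mathbb{R}$ and $C>0$ with $|g(x)-g_\infty|\le C/\log(e+|x|)$ for all $x$. Space. For $0\le\lambda<\infty$, $1\le p<\infty$, $\theta>0$, $M\dot{K}^{\alpha(\cdot),\lambda,\theta}_{q(\cdot),p)}(A;\mathbb{R}^n)$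 is the set of $f\in L^{q(\cdot)}_{\rm loc}(\mathbb{R}^n\setminus\{0\})$ with $$\|f\|_{M\dot{K}^{\alpha(\cdot),\lambda,\theta}_{q(\cdot),p)}(A;\mathbb{R}^n)}=\sup_{\varepsilon>0}\sup_{L\in\mathbb{Z}}b^{-L\lambda}\Big(\varepsilon^\theta\sum_{k=-\infty}^L\|b^{k\alpha(\cdot)}f\chi_k\|_{L^{q(\cdot)}(\mathbb{R}^n)}^{p(1+\varepsilon)}\Big)^{\frac1{p(1+\varepsilon)}}<\infty.$$ *)

(* Defs.v *)
From HB Require Import structures.
From mathcomp Require Import all_boot all_order all_algebra.
From mathcomp Require Import all_classical all_reals all_analysis.
From mathcomp Require Import ess_sup_inf complex.

Set Implicit Arguments.
Unset Strict Implicit.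
Unset Printing Implicit Defensive.
Import Order.TTheory GRing.Theory Num.Theory.
Import numFieldNormedType.Exports.

Local Open Scope classical_set_scope.
Local Open Scope ring_scope.
Local Open Scope complex_scope.

(* The dimension is n.+1 >= 1: R^(n+1) is the type 'cV[R]_n.+1 of column
   vectors.  Its library norm is the sup norm, which gives the usual topology
   (used for compact sets); |x| in R^(n+1) is the Euclidean norm below. *)

Definition euclidean_norm (R : realType) (n : nat) (x : 'cV[R]_n.+1) : R :=
  Num.sqrt (\sum_(i < n.+1) x i ord0 ^+ 2).

(* Lebesgue measure: the outer measure generated by the volumes of half-open
   boxes, restricted by Caratheodory's theorem to the (complete) sigma-algebra
   of Lebesgue measurable sets. *)

Section LebesgueOuterMeasure.
Variables (R : realType) (n : nat).

Definition box (ab : 'cV[R]_n.+1 * 'cV[R]_n.+1) : set 'cV[R]_n.+1 :=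
  [set x | forall i, ab.1 i ord0 < x i ord0 <= ab.2 i ord0].

Definition box_volume (ab : 'cV[R]_n.+1 * 'cV[R]_n.+1) : R :=
  \prod_(i < n.+1) Num.max 0 (ab.2 i ord0 - ab.1 i ord0).

Definition box_cover (X : set 'cV[R]_n.+1) :
    set (nat -> 'cV[R]_n.+1 * 'cV[R]_n.+1) :=
  [set u | X `<=` \bigcup_k box (u k)].

Definition lebesgue_outer (X : set 'cV[R]_n.+1) : \bar R :=
  ereal_inf [set (\sum_(k <oo) (box_volume (u k))%:E)%E | u in box_cover X].

Let vol_ge0 ab : (0 <= (box_volume ab)%:E)%E.
Proof. by rewrite lee_fin; apply: prodr_ge0 => i _; rewrite le_max lexx. Qed.

Lemma lebesgue_outer_ge0 X : (0 <= lebesgue_outer X)%E.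
Proof.
apply: le_ereal_inf_tmp => _ [u _ <-].
by apply: nneseries_ge0 => k _ _; exact: vol_ge0.
Qed.

Lemma lebesgue_outer_le :
  {homo lebesgue_outer : A B / A `<=` B >-> (A <= B)%E}.
Proof.
move=> A B AB; apply/ereal_inf_le_tmp => _ [u Bu <-].
by exists u => //; exact: subset_trans Bu.
Qed.

Lemma lebesgue_outer0 : lebesgue_outer set0 = 0%E.
Proof.
apply/eqP; rewrite eq_le lebesgue_outer_ge0 andbT.
apply: ereal_inf_lbound; exists (fun=> (0, 0)); first exact: sub0set.
rewrite eseries0// => k _ _.
by rewrite /box_volume big_ord_recl/= subrr maxxx mul0r.
Qed.

Local Open Scope ereal_scope.

Lemma lebesgue_outer_sigma_subadditive : sigma_subadditive lebesgue_outer.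
Proof.
move=> A; have [[i ioo]|] := pselect (exists i, lebesgue_outer (A i) = +oo).
  rewrite (eseries_pinfty _ _ ioo) ?leey// => k _.
  by rewrite -ltNye (lt_le_trans _ (lebesgue_outer_ge0 _)).
rewrite -forallNE => Aoo.
suff add2e (e : {posnum R}) :
    lebesgue_outer (\bigcup_k A k) <=
    \sum_(i <oo) lebesgue_outer (A i) + e%:num%:E.
  by apply/lee_addgt0Pr => _/posnumP[].
rewrite (le_trans _ (epsilon_trick _ _ _))//; last first.
  by move=> k; exact: lebesgue_outer_ge0.
pose P k u := box_cover (A k) u /\
  \sum_(j <oo) (box_volume (u j))%:E <=
  lebesgue_outer (A k) + (e%:num / (2 ^ k.+1)%:R)%:E.
have [G PG] : {G & forall k, P k (G k)}.
  apply: (@choice _ _ P) => k; rewrite /P /lebesgue_outer.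
  set S := (X in ereal_inf X); move infS : (ereal_inf S) => iS.
  case: iS infS => [r Sr|Soo|Soo].
  - have en1 : (0 < e%:num / (2 ^ k.+1)%:R)%R by [].
    have /(lb_ereal_inf_adherent en1) : ereal_inf S \is a fin_num by rewrite Sr.
    move=> [_ [u Au <-] xS].
    by exists u; split => //; rewrite -Sr; exact/ltW.
  - by have := Aoo k; rewrite /lebesgue_outer Soo.
  - by have := lebesgue_outer_ge0 (A k); rewrite /lebesgue_outer Soo.
pose v := (fun ij : nat * nat => (box_volume (G ij.1 ij.2))%:E).
have v_ge0 ij : 0 <= v ij by exact: vol_ge0.
apply: (@le_trans _ _ (\esum_(i in setT) v i)).
  apply: ereal_inf_lbound => /=.
  have /card_esym/ppcard_eqP[f] := card_nat2.
  exists (uncurry G \o f).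
    move=> t [i _ /(PG i).1[j _ Bijt]].
    by exists (f^-1%FUN (i, j)) => //=; rewrite invK ?inE.
  transitivity (\sum_(k <oo) (v \o f) k).
    by apply: eq_eseriesr => k _ /=; rewrite /v /uncurry; case: (f k).
  rewrite -(esum_pred_image v _ xpredT) ?[fun=> _]set_true//.
  by rewrite image_eq.
rewrite (_ : esum _ _ = \sum_(i <oo) \sum_(j <oo) v (i, j)); last first.
  pose J : nat -> set (nat * nat) := fun i => [set (i, j) | j in setT].
  rewrite (_ : setT = \bigcup_k J k); last first.
    by rewrite predeqE => -[a b]; split => // _; exists a => //; exists b.
  rewrite esum_bigcupT //=; last first.
    apply/trivIsetP => i j _ _ ij.
    rewrite predeqE => -[k m] /=; split => //= -[] [_] _ [<-{k} _].
    by move=> [m' _] [] /esym/eqP; rewrite (negbTE ij).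
  rewrite -(image_id [set: nat]) -fun_true esum_pred_image//; last first.
    by move=> k _; exact: esum_ge0.
  apply: eq_eseriesr => /= j _.
  rewrite -(esum_pred_image v (pair j) predT)//=; last first.
    by move=> ? ? _ _; exact: (@can_inj _ _ _ snd).
  by congr esum; rewrite predeqE => -[a b]; split; move=> [i _ <-]; exists i.
by apply: lee_nneseries => [k _ _|k _]; [exact: nneseries_ge0|exact: (PG k).2].
Qed.

HB.instance Definition _ := isOuterMeasure.Build R 'cV[R]_n.+1 lebesgue_outer
  lebesgue_outer0 lebesgue_outer_ge0 lebesgue_outer_le
  lebesgue_outer_sigma_subadditive.

Definition lebesgue_outer_measure :
  {outer_measure set 'cV[R]_n.+1 -> \bar R} := lebesgue_outer.

End LebesgueOuterMeasure.

Notation Leb R n := (caratheodory_type (lebesgue_outer_measure R n)).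

Definition lebesgue (R : realType) (n : nat) :
  {measure set (Leb R n) -> \bar R} := lebesgue_outer_measure R n.

Section Dilations.
Variables (R : realType) (n : nat).
Implicit Types (A P : 'M[R]_n.+1).

(* A is mapped to a complex matrix so that all its eigenvalues are seen. *)
Definition dilation A : Prop :=
  forall l : R[i], eigenvalue (map_mx (real_complex R) A) l -> 1 < `|l|.

Definition ellipsoid P : set 'cV[R]_n.+1 :=
  [set x | euclidean_norm (P *m x) < 1].

Definition admissible_ellipsoid A P (r : R) : Prop :=
  let D := ellipsoid P in
  [/\ P \in unitmx, lebesgue R n D = 1%E, 1 < r,
      D `<=` [set r *: x | x in D] &
      [set r *: x | x in D] `<=` [set A *m x | x in D]].

Definition dilated_ball A P (k : int) : set 'cV[R]_n.+1 :=
  [set A ^ k *m x | x in ellipsoid P].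

Definition annulus A P (k : int) : set 'cV[R]_n.+1 :=
  dilated_ball A P k `\` dilated_ball A P (k - 1).

End Dilations.

Section VariableExponents.
Variables (R : realType) (n : nat).
Implicit Types (g q : 'cV[R]_n.+1 -> R) (f : 'cV[R]_n.+1 -> R[i]).

(* At x = 0 the left-hand side is 0, so the value of 1 / |0| is irrelevant. *)
Definition log_holder_origin g : Prop :=
  exists2 C : R, 0 < C & forall x,
    `|g x - g 0| <= C / ln (expR 1 + (euclidean_norm x)^-1).

Definition log_holder_infinity g : Prop :=
  exists ginf : R, exists2 C : R, 0 < C & forall x,
    `|g x - ginf| <= C / ln (expR 1 + euclidean_norm x).

Definition variable_exponent q : Prop :=
  [/\ measurable_fun [set: Leb R n] q, (forall x, 1 <= q x),
      (1 < ess_inf (lebesgue R n) (EFin \o q))%E &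
      (ess_sup (lebesgue R n) (EFin \o q) < +oo)%E].

Definition complex_measurable (E : set (Leb R n)) f : Prop :=
  measurable_fun E (fun x : Leb R n => complex.Re (f x)) /\
  measurable_fun E (fun x : Leb R n => complex.Im (f x)).

(* Luxemburg norm; the infimum of the empty set is +oo. *)
Definition Lq_norm q f : \bar R :=
  ereal_inf [set l%:E | l in [set l : R | 0 < l /\
    (\int[lebesgue R n]_(x in [set: Leb R n])
      ((ComplexField.Normc.normc (f x) / l) `^ q x)%:E <= 1)%E]].

Definition Lq_loc q (Omega : set 'cV[R]_n.+1) f : Prop :=
  complex_measurable Omega f /\
  forall E : set 'cV[R]_n.+1, compact E -> E `<=` Omega ->
    (Lq_norm q (fun x => ((\1_E x)%:C * f x)%R) < +oo)%E.

End VariableExponents.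

Section GrandHerzMorrey.
Variables (R : realType) (n : nat).

Definition grand_herz_morrey_norm (A P : 'M[R]_n.+1)
    (alpha q : 'cV[R]_n.+1 -> R) (lambda theta p : R)
    (f : 'cV[R]_n.+1 -> R[i]) : \bar R :=
  let b := `|\det A| in
  ereal_sup [set ereal_sup [set
      ((b `^ (- (L%:~R * lambda)))%:E *
       ((e `^ theta)%:E *
        \esum_(k in [set k : int | (k <= L)%R])
          (Lq_norm q (fun x =>
             ((b `^ (k%:~R * alpha x) * \1_(annulus A P k) x)%:C * f x)%R))
          `^ (p * (1 + e))%R)
       `^ (p * (1 + e))^-1%R)%E
    | L in [set: int]] | e in [set e : R | 0 < e]].

(* Functions on R^(n+1) \ {0} are represented by functions on R^(n+1) whose
   value at 0 plays no role. *)
Definition grand_herz_morrey (A P : 'M[R]_n.+1)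
    (alpha q : 'cV[R]_n.+1 -> R) (lambda theta p : R) :
    set ('cV[R]_n.+1 -> R[i]) :=
  [set f | Lq_loc q (~` [set 0]) f /\
    (grand_herz_morrey_norm A P alpha q lambda theta p f < +oo)%E].

End GrandHerzMorrey.

(* Main.v *)
Require Import Defs.
From mathcomp Require Import all_boot all_order all_algebra.
From mathcomp Require Import all_classical all_reals all_analysis.
From mathcomp Require Import measurable_realfun ess_sup_inf complex.
From mathcomp Require Import ring lra.

Set Implicit Arguments.
Unset Strict Implicit.
Unset Printing Implicit Defensive.
Local Open Scope classical_set_scope.
Local Open Scope ring_scope.

Import Order.TTheory GRing.Theory Num.Theory.
Import numFieldNormedType.Exports.

(** The space is built from three layers of norms, each of which satisfies a
    triangle inequality.

    The innermost layer is the Luxemburg norm of L^q(.).  If l and m are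
    admissible constants for f and g, then l + m is admissible for f + g,
    because t |-> t ^ q(x) is convex and increasing and
    |f + g| / (l + m) is at most the convex combination of |f| / l and |g| / m
    with weights l / (l + m) and m / (l + m) ([powR_add_div_le],
    [Lq_norm_triangle]).  The middle layer is the l^s norm of the sequence of
    annular pieces, s = p (1 + e) >= 1; the same convexity argument gives
    Minkowski's inequality there ([esum_minkowski]).  The outermost layer is a
    supremum of nonnegative multiples of l^s norms, which is subadditive.

    The integral is additive on measurable functions only, so the pieces
    b^(k alpha) 1_(C_k) f have to be Lebesgue measurable.  Half-spaces satisfy
    Caratheodory's criterion, since a hyperplane orthogonal to an axis cuts a box
    into two boxes whose volumes add up ([measurable_halfspace]); hence the
    coordinates, the balls B_k, and the open and compact sets are measurable.
    The function f is only known to be measurable away from the origin, but the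
    cut-offs 1_(C_k) and 1_E vanish at the origin ([complex_measurableZ]). *)

(** * Borel sets are Lebesgue measurable *)

Section LebesgueMeasurable.
Variables (R : realType) (n : nat).
Implicit Types (i : 'I_n.+1) (c : R) (ab : 'cV[R]_n.+1 * 'cV[R]_n.+1).

(** The intersection of the box [ab] with the half-space {x | c < x_i}. *)
Definition box_above i c ab : 'cV[R]_n.+1 * 'cV[R]_n.+1 :=
  (\col_j (if j == i then Num.max (ab.1 j ord0) c else ab.1 j ord0), ab.2).

(** The intersection of the box [ab] with the half-space {x | x_i <= c}. *)
Definition box_below i c ab : 'cV[R]_n.+1 * 'cV[R]_n.+1 :=
  (ab.1, \col_j (if j == i then Num.min (ab.2 j ord0) c else ab.2 j ord0)).

Lemma box_volume_cut i c ab :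
  box_volume (box_above i c ab) + box_volume (box_below i c ab) = box_volume ab.
Proof.
rewrite /box_volume (bigD1 i)//= [X in _ + X](bigD1 i)//= [RHS](bigD1 i)//=.
rewrite (eq_bigr (fun j => Num.max 0 (ab.2 j ord0 - ab.1 j ord0))); last first.
  by move=> j ji; rewrite mxE (negbTE ji).
rewrite [X in _ + _ * X](eq_bigr
    (fun j => Num.max 0 (ab.2 j ord0 - ab.1 j ord0))); last first.
  by move=> j ji; rewrite mxE (negbTE ji).
rewrite -mulrDl !mxE eqxx; congr (_ * _).
rewrite /Num.max /Num.min.
by repeat case: ifPn => //; rewrite -?leNgt; lra.
Qed.

Lemma box_volume_ge0 ab : 0 <= box_volume ab.
Proof. by apply: prodr_ge0 => i _; rewrite le_max lexx. Qed.

(** Cutting every box of a cover of X along the hyperplane x_i = c gives covers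
    of the two parts of X with the same total volume. *)
Lemma measurable_halfspace i c :
  measurable ([set x | c < x i ord0] : set (Leb R n)).
Proof.
apply: le_caratheodory_measurable => X.
apply: le_ereal_inf_tmp => _ [u Xu <-].
have vE k : ((box_volume (u k))%:E = (box_volume (box_above i c (u k)))%:E +
    (box_volume (box_below i c (u k)))%:E)%E.
  by rewrite -EFinD box_volume_cut.
under eq_eseriesr do rewrite vE.
rewrite nneseriesD; last 2 first.
- by move=> k _ _; rewrite lee_fin box_volume_ge0.
- by move=> k _ _; rewrite lee_fin box_volume_ge0.
apply: leeD; apply: ereal_inf_lbound.
- exists (box_above i c \o u) => //= x [Xx /= cx].
  have [k _ bx] := Xu _ Xx; exists k => // j; rewrite /= mxE.
  have /andP[a_lt_x ->] := bx j; rewrite andbT.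
  by case: eqP => // ->; rewrite gt_max cx andbT; have /andP[] := bx i.
- exists (box_below i c \o u) => //= x [Xx /= /negP cx].
  have [k _ bx] := Xu _ Xx; exists k => // j; rewrite /= mxE.
  have /andP[-> x_le_b] := bx j => /=.
  case: eqP => // ->; rewrite le_min [X in _ && X]leNgt cx andbT.
  by have /andP[] := bx i.
Qed.

Lemma measurable_coord i :
  measurable_fun [set: Leb R n] (fun x : Leb R n => (x : 'cV[R]_n.+1) i ord0).
Proof.
apply: (measurability _ (RGenOInfty.measurableE R)).
move=> _ [_ [c ->] <-]; rewrite setTI.
rewrite (_ : _ @^-1` _ = [set x : Leb R n | c < (x : 'cV_n.+1) i ord0]).
  exact: measurable_halfspace.
by apply/seteqP; split=> x /=; rewrite in_itv/= andbT.
Qed.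

Lemma measurable_linear_ball (M : 'M[R]_n.+1) :
  measurable ([set x | euclidean_norm (M *m x) < 1] : set (Leb R n)).
Proof.
pose h (x : Leb R n) :=
  \sum_(i < n.+1) (\sum_(j < n.+1) M i j * (x : 'cV_n.+1) j ord0) ^+ 2.
have mh : measurable_fun [set: Leb R n] h.
  apply: measurable_sum => i; apply: measurable_funX; apply: measurable_sum => j.
  by apply: measurable_funM => //; exact: measurable_coord.
have sqrt_lt1 (z : R) : (Num.sqrt z < 1) = (z < 1).
  by rewrite -[X in (_ < X) = _]sqrtr1 ltr_sqrt.
have hE x : h x = \sum_(i < n.+1) (M *m x) i ord0 ^+ 2.
  by apply: eq_bigr => i _; rewrite mxE.
rewrite (_ : [set x : Leb R n | _] = [set: Leb R n] `&` h @^-1` `]-oo, 1[).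
  by apply: mh.
rewrite setTI; apply/seteqP; split => x /=; rewrite in_itv/= /euclidean_norm.
all: by rewrite sqrt_lt1 hE.
Qed.

(** An open set is the countable union of the open cubes that it contains with
    rational centre and half-side 1 / (k + 1). *)
Lemma measurable_open (U : set 'cV[R]_n.+1) :
  open U -> measurable (U : set (Leb R n)).
Proof.
move=> oU.
pose Q (c : 'cV[rat]_n.+1 * nat) : set (Leb R n) :=
  \bigcap_i [set x : Leb R n |
    `|(x : 'cV_n.+1) i ord0 - ratr (c.1 i ord0)| < c.2.+1%:R^-1].
have mQ (c : 'cV[rat]_n.+1 * nat) : measurable (Q c).
  apply: fin_bigcap_measurable => // i _.
  pose h (x : Leb R n) := `|(x : 'cV_n.+1) i ord0 - ratr (c.1 i ord0)|.
  have mh : measurable_fun [set: Leb R n] h.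
    apply: measurableT_comp => //; apply: measurable_funB => //.
    exact: measurable_coord.
  rewrite (_ : [set x : Leb R n | _] =
      [set: Leb R n] `&` h @^-1` `]-oo, c.2.+1%:R^-1[%classic).
    by apply: mh.
  by rewrite setTI; apply/seteqP; split => x /=; rewrite in_itv.
rewrite (_ : U = \bigcup_c (if `[< Q c `<=` U >] then Q c else set0)).
  apply: countable_bigcupT_measurable => // c.
  by case: ifPn.
apply/seteqP; split => [x Ux|x [c _]]; last by case: asboolP => // QU /QU.
have /nbhs_ballP[e /= e0 xeU] := oU _ Ux.
(* A cube of half-side d containing x lies in the ball of radius 2 * d around x. *)
have [k ke] : exists k, 2 * k.+1%:R^-1 < e.
  have [k] := ltr_add_invr (y := 0) (x := e / 2) (divr_gt0 e0 (ltr0n _ 2)).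
  by rewrite add0r => ke; exists k; rewrite mulrC -ltr_pdivlMr.
have k0 : 0 < k.+1%:R^-1 :> R by rewrite invr_gt0.
have [c cx] : {c : 'cV[rat]_n.+1 &
    forall i, `|x i ord0 - ratr (c i ord0)| < k.+1%:R^-1}.
  have /choice[c cx] i : exists a : rat, `|x i ord0 - ratr a| < k.+1%:R^-1.
    have [a] : exists a, ratr a \in `]x i ord0 - k.+1%:R^-1, x i ord0 + k.+1%:R^-1[.
      by apply: rat_in_itvoo; rewrite ltrD2l (lt_trans _ k0)// oppr_lt0.
    by rewrite in_itv/= => ?; exists a; rewrite distrC ltr_distl.
  by exists (\col_i c i) => i; rewrite mxE.
exists (c, k) => //; case: asboolP => [_ i _|]; first exact: cx.
case=> y Qy; apply: xeU; split => // i j; rewrite ord1 /ball/=.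
have := Qy i I => /=; have := cx i.
set u := x i ord0; set v := y i ord0; set w := ratr _ => uw vw.
have -> : u - v = (u - w) - (v - w) by lra.
apply: le_lt_trans (ler_normB _ _) (lt_trans _ ke).
by rewrite mulr_natl mulr2n ltrD.
Qed.

Lemma measurable_closed (U : set 'cV[R]_n.+1) :
  closed U -> measurable (U : set (Leb R n)).
Proof.
rewrite -openC -[X in measurable X]setCK => oU.
by apply: measurableC; exact: measurable_open.
Qed.
End LebesgueMeasurable.

(** * Convexity of powers and Minkowski's inequality for sums *)

Section PowerConvexity.
Variable R : realType.

(** The convexity inequality that makes l + m an admissible Luxemburg constant
    for a sum as soon as l and m are admissible for its terms. *)
Lemma powR_add_div_le (s l m x y z : R) : 1 <= s -> 0 < l -> 0 < m ->
  0 <= x -> 0 <= y -> 0 <= z -> z <= x + y ->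
  (z / (l + m)) `^ s <=
    l / (l + m) * (x / l) `^ s + m / (l + m) * (y / m) `^ s.
Proof.
move=> s1 l0 m0 x0 y0 z0 zxy.
have lm0 : 0 < l + m by rewrite addr_gt0.
have t0 : 0 <= l / (l + m) by rewrite divr_ge0// ltW.
have t1 : l / (l + m) <= 1 by rewrite ler_pdivrMr// mul1r lerDl ltW.
have cvx : (l / (l + m) * (x / l) + m / (l + m) * (y / m)) `^ s <=
    l / (l + m) * (x / l) `^ s + m / (l + m) * (y / m) `^ s.
  have -> : m / (l + m) = 1 - l / (l + m) by field; rewrite gt_eqF.
  have := @convex_powR R s s1 (Itv01 t0 t1) (x / l) (y / m).
  by rewrite !inE/= !in_itv/= !andbT; apply; rewrite divr_ge0// ltW.
apply: le_trans cvx; apply: ge0_ler_powR.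
- by rewrite (le_trans _ s1).
- by rewrite nnegrE divr_ge0// ltW.
- by rewrite nnegrE addr_ge0// mulr_ge0// divr_ge0// ltW.
rewrite (_ : _ * _ + _ = (x + y) / (l + m)); last first.
  by field; rewrite !gt_eqF.
by rewrite ler_wpM2r// invr_ge0 ltW.
Qed.

Local Open Scope ereal_scope.

(** [powR_add_div_le] multiplied by (l + m) ^ s, for extended reals. *)
Lemma poweR_add_le (s l m : R) (x y z : \bar R) :
  (1 <= s)%R -> (0 < l)%R -> (0 < m)%R ->
  0 <= x -> 0 <= y -> 0 <= z -> z <= x + y ->
  z `^ s <=
    ((l + m) `^ s * (l / (l + m)) / l `^ s)%:E * x `^ s +
    ((l + m) `^ s * (m / (l + m)) / m `^ s)%:E * y `^ s.
Proof.
move=> s1 l0 m0.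
have s0 : (0 < s)%R by rewrite (lt_le_trans _ s1).
have lm0 : (0 < l + m)%R by rewrite addr_gt0.
have K0 (k : R) : (0 < k)%R -> (0 < (l + m) `^ s * (k / (l + m)) / k `^ s)%R.
  by move=> k0; rewrite divr_gt0 ?powR_gt0// mulr_gt0 ?powR_gt0// divr_gt0.
have big (k : R) (u : \bar R) : 0 <= u -> (0 < k)%R ->
    0 <= ((l + m) `^ s * (k / (l + m)) / k `^ s)%:E * u `^ s.
  by move=> u0 k0; rewrite mule_ge0 ?poweR_ge0// lee_fin ltW// K0.
case: x => [x| |] // x0; last first.
  move=> y0 z0 _; rewrite poweRyr ?gt_eqF// gt0_muley ?lte_fin ?K0//.
  by rewrite addye ?leey// gt_eqF// (lt_le_trans _ (big _ _ _ _))// ltNyr.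
case: y => [y| |] // y0; last first.
  move=> z0 _; rewrite poweRyr ?gt_eqF// gt0_muley ?lte_fin ?K0//.
  by rewrite addey ?leey// gt_eqF// (lt_le_trans _ (big _ _ _ _))// ltNyr.
case: z => [z| |] // z0 zxy.
move: x0 y0 z0 zxy; rewrite -EFinD !lee_fin => x0 y0 z0 zxy.
have /(ler_wpM2l (ltW (powR_gt0 s lm0))) := powR_add_div_le s1 l0 m0 x0 y0 z0 zxy.
rewrite -powRM ?divr_ge0 ?(ltW lm0)//.
rewrite (_ : (l + m) * (z / (l + m)) = z)%R; last by field; rewrite gt_eqF.
move=> /le_trans; apply.
have E (u k : R) : (0 <= u)%R -> (0 < k)%R -> ((u / k) `^ s = u `^ s / k `^ s)%R.
  move=> u0 k0; rewrite powRM ?invr_ge0 ?(ltW k0)//; congr (_ * _)%R.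
  by rewrite -(powR_inv1 (ltW k0)) -powRrM mulN1r powRN.
rewrite !E// mulrDr le_eqVlt; apply/orP; left; apply/eqP.
by congr (_ + _)%R; ring.
Qed.

Lemma esumZl_le (T : choiceType) (D : set T) (a : T -> \bar R) (k : R) :
  (0 < k)%R -> (forall i, 0 <= a i) ->
  \esum_(i in D) (k%:E * a i) <= k%:E * \esum_(i in D) a i.
Proof.
move=> k0 a0; apply: ge_ereal_sup => _ [X [finX XD] <-].
rewrite -ge0_mule_fsumr// lee_pmul2l// ereal_sup_ubound//.
by exists X.
Qed.

Lemma esum_minkowski (T : choiceType) (D : set T) (a b c : T -> \bar R) (s : R) :
  (1 <= s)%R -> (forall k, D k -> 0 <= a k) -> (forall k, D k -> 0 <= b k) ->
  (forall k, D k -> 0 <= c k <= a k + b k) ->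
  (\esum_(k in D) c k `^ s) `^ s^-1 <=
    (\esum_(k in D) a k `^ s) `^ s^-1 + (\esum_(k in D) b k `^ s) `^ s^-1.
Proof.
move=> s1 a0 b0 cab.
have s0 : (0 < s)%R by rewrite (lt_le_trans _ s1).
have powK (S : \bar R) : 0 <= S -> (S `^ s^-1) `^ s = S.
  by move=> S0; rewrite -poweRrM mulVf ?gt_eqF// poweRe1.
have Kpow (S : \bar R) : 0 <= S -> (S `^ s) `^ s^-1 = S.
  by move=> S0; rewrite -poweRrM mulfV ?gt_eqF// poweRe1.
have mono (t : R) (x y : \bar R) : (0 < t)%R ->
    0 <= x -> x <= y -> x `^ t <= y `^ t.
  move=> t0 x0 xy; apply: gt0_ler_poweR => //; first exact: ltW.
    by rewrite in_itv/= x0 leey.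
  by rewrite in_itv/= (le_trans x0 xy) leey.
have sum0 (u : T -> \bar R) : 0 <= \esum_(k in D) u k `^ s.
  by apply: esum_ge0 => k _; exact: poweR_ge0.
set F := (X in _ <= X + _); set G := (X in _ <= _ + X).
have F0 : 0 <= F by exact: poweR_ge0.
have G0 : 0 <= G by exact: poweR_ge0.
have [->|Foo] := eqVneq F +oo.
  by rewrite addye ?leey// gt_eqF// (lt_le_trans _ G0).
have [->|Goo] := eqVneq G +oo.
  by rewrite addey ?leey// gt_eqF// (lt_le_trans _ F0).
have Ffin : F \is a fin_num by rewrite ge0_fin_numE// lt_neqAle Foo leey.
have Gfin : G \is a fin_num by rewrite ge0_fin_numE// lt_neqAle Goo leey.
apply/lee_addgt0Pr => e e0.
(* F and G are increased by e / 2 since they may be 0, whereas the constants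
   must be positive. *)
pose l := (fine F + e / 2)%R; pose m := (fine G + e / 2)%R.
have l0 : (0 < l)%R by rewrite ltr_wpDl ?fine_ge0// divr_gt0.
have m0 : (0 < m)%R by rewrite ltr_wpDl ?fine_ge0// divr_gt0.
have lm0 : (0 < l + m)%R by rewrite addr_gt0.
have Sa : \esum_(k in D) a k `^ s <= (l `^ s)%:E.
  rewrite -[leLHS]powK ?sum0// -poweR_EFin; apply: mono => //.
  by rewrite -/F -(fineK Ffin) lee_fin lerDl divr_ge0// ltW.
have Sb : \esum_(k in D) b k `^ s <= (m `^ s)%:E.
  rewrite -[leLHS]powK ?sum0// -poweR_EFin; apply: mono => //.
  by rewrite -/G -(fineK Gfin) lee_fin lerDl divr_ge0// ltW.
have -> : F + G + e%:E = (l + m)%:E.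
  rewrite -(fineK Ffin) -(fineK Gfin) -!EFinD; congr EFin.
  by rewrite /l /m; lra.
rewrite -[leRHS]Kpow ?lee_fin ?(ltW lm0)//; apply: mono; rewrite ?invr_gt0//.
have K0 (k : R) : (0 < k)%R -> (0 < (l + m) `^ s * (k / (l + m)) / k `^ s)%R.
  by move=> k0; rewrite divr_gt0 ?powR_gt0// mulr_gt0 ?powR_gt0// divr_gt0.
have le1 k : D k -> _ := fun Dk => poweR_add_le s1 l0 m0 (a0 k Dk) (b0 k Dk)
  (andP (cab k Dk)).1 (andP (cab k Dk)).2.
apply: le_trans (le_esum le1) _.
rewrite esumD; last 2 first.
- by move=> k _; rewrite mule_ge0 ?poweR_ge0// lee_fin ltW// K0.
- by move=> k _; rewrite mule_ge0 ?poweR_ge0// lee_fin ltW// K0.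
apply: (@le_trans _ _ (((l + m) `^ s * (l / (l + m)) / l `^ s)%:E * (l `^ s)%:E +
    ((l + m) `^ s * (m / (l + m)) / m `^ s)%:E * (m `^ s)%:E)).
  apply: leeD.
    apply: le_trans.
    apply: esumZl_le; [exact: K0|by move=> k; exact: poweR_ge0].
    by rewrite lee_pmul2l// lte_fin K0.
  apply: le_trans.
    apply: esumZl_le; [exact: K0|by move=> k; exact: poweR_ge0].
  by rewrite lee_pmul2l// lte_fin K0.
rewrite -!EFinM -EFinD poweR_EFin lee_fin !divfK ?gt_eqF ?powR_gt0//.
by rewrite -mulrDr -mulrDl divff ?mulr1// gt_eqF.
Qed.
(** Weights w outside and c inside the power scale all three terms by w * c ^ t. *)
Lemma weighted_poweR_add_le (w c x y z : \bar R) (t : R) :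
  0 <= w -> 0 <= c -> 0 <= z -> 0 <= x -> 0 <= y ->
  z `^ t <= x `^ t + y `^ t ->
  w * (c * z) `^ t <= w * (c * x) `^ t + w * (c * y) `^ t.
Proof.
move=> w0 c0 z0 x0 y0 zxy.
rewrite -ge0_muleDr ?poweR_ge0//; apply: lee_wpmul2l => //.
rewrite !poweRM// -ge0_muleDr ?poweR_ge0//; apply: lee_wpmul2l => //.
exact: poweR_ge0.
Qed.

End PowerConvexity.

(** * The triangle inequality of the Luxemburg norm *)

(** If w lies below a convex combination of u and v, then an upper bound 1 on the
    integrals of u and v passes to w. *)
Lemma integral_convex_le d (T : measurableType d) (R : realType)
    (mu : {measure set T -> \bar R}) (t s : R) (u v w : T -> R) :
  0 <= t -> 0 <= s -> t + s = 1 ->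
  measurable_fun [set: T] (EFin \o u) -> measurable_fun [set: T] (EFin \o v) ->
  measurable_fun [set: T] (EFin \o w) ->
  (forall x, 0 <= u x) -> (forall x, 0 <= v x) -> (forall x, 0 <= w x) ->
  (forall x, w x <= t * u x + s * v x) ->
  (\int[mu]_(x in [set: T]) (u x)%:E <= 1)%E ->
  (\int[mu]_(x in [set: T]) (v x)%:E <= 1)%E ->
  (\int[mu]_(x in [set: T]) (w x)%:E <= 1)%E.
Proof.
move=> t0 s0 ts1 mu' mv mw u0 v0 w0 wuv u1 v1.
have cu0 x : [set: T] x -> (0 <= t%:E * (u x)%:E)%E.
  by move=> _; rewrite mule_ge0// lee_fin.
have cv0 x : [set: T] x -> (0 <= s%:E * (v x)%:E)%E.
  by move=> _; rewrite mule_ge0// lee_fin.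
apply: (@le_trans _ _
    (\int[mu]_(x in [set: T]) (t%:E * (u x)%:E + s%:E * (v x)%:E))%E).
  apply: ge0_le_integral => //.
  - by move=> x _; rewrite lee_fin.
  - by apply: emeasurable_funD; exact: measurable_funeM.
  - by move=> x _; rewrite -!EFinM -EFinD lee_fin.
rewrite ge0_integralD//; [|exact: measurable_funeM..].
rewrite !ge0_integralZl ?lee_fin//; do ?by move=> x _; rewrite lee_fin.
apply: (@le_trans _ _ (t%:E * 1 + s%:E * 1)%E).
  by apply: leeD; apply: lee_wpmul2l; rewrite ?lee_fin.
by rewrite !mule1 -EFinD ts1.
Qed.

Section VariableLebesgue.
Variables (R : realType) (n : nat).
Implicit Types (q u : 'cV[R]_n.+1 -> R) (f g h : 'cV[R]_n.+1 -> R[i]).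

Lemma measurable_powR2 d (T : measurableType d) (D : set T) (u v : T -> R) :
  measurable_fun D u -> measurable_fun D v ->
  measurable_fun D (fun x => u x `^ v x).
Proof.
move=> mu mv mD; rewrite /powR; apply: (measurable_fun_if mD) => //.
- by apply: measurable_fun_eqr.
- apply: (measurableT_comp (f := fun b : bool => b%:R : R)) => //.
  by apply: measurable_fun_eqr => //; exact: measurable_funS mv.
- apply: measurableT_comp => //; apply: measurable_funM.
    exact: measurable_funS mv.
  by apply: measurableT_comp => //; exact: measurable_funS mu.
Qed.

Lemma complex_measurableD (D : set (Leb R n)) f g : complex_measurable D f ->
  complex_measurable D g -> complex_measurable D (fun x => f x + g x)%R.
Proof.
move=> [fr fi] [gr gi]; split.
- rewrite (_ : (fun x => _) = (fun x => complex.Re (f x) + complex.Re (g x))).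
    exact: measurable_funD.
  by apply/funext => x; case: (f x) (g x) => [? ?] [? ?].
- rewrite (_ : (fun x => _) = (fun x => complex.Im (f x) + complex.Im (g x))).
    exact: measurable_funD.
  by apply/funext => x; case: (f x) (g x) => [? ?] [? ?].
Qed.

(** A real factor that vanishes at the origin makes a function that is measurable
    off the origin measurable everywhere, whatever its value at the origin. *)
Lemma complex_measurableZ u f : measurable_fun [set: Leb R n] u -> u 0 = 0 ->
  complex_measurable (~` [set 0]) f ->
  complex_measurable [set: Leb R n] (fun x => (u x)%:C%C * f x)%R.
Proof.
move=> mu u0 [fr fi].
have m0 : measurable (~` [set 0] : set (Leb R n)).
  apply: measurable_open; rewrite openC.
  apply: accessible_closed_set1; apply: hausdorff_accessible.
  exact: (@norm_hausdorff R 'cV[R]_n.+1).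
have ext (v : 'cV[R]_n.+1 -> R) :
    measurable_fun (~` [set 0] : set (Leb R n)) v ->
    measurable_fun [set: Leb R n] (fun x => u x * v x).
  move=> mv.
  rewrite (_ : (fun x => _) = (fun x : Leb R n => u x * (v \_ (~` [set 0])) x)).
    apply: (measurable_funM mu).
    by apply/(measurable_restrictT _ m0).
  apply/funext => x; rewrite patchE; case: ifPn => //.
  by rewrite notin_setE/= => /contrapT ->; rewrite u0 !mul0r.
split.
- rewrite (_ : (fun x => _) = (fun x => u x * complex.Re (f x))); first exact: ext.
  by apply/funext => x; case: (f x) => [? ?] /=; rewrite mul0r subr0.
- rewrite (_ : (fun x => _) = (fun x => u x * complex.Im (f x))); first exact: ext.
  by apply/funext => x; case: (f x) => [? ?] /=; rewrite mul0r addr0.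
Qed.

Lemma measurable_modular q f (l : R) : measurable_fun [set: Leb R n] q ->
  complex_measurable [set: Leb R n] f ->
  measurable_fun [set: Leb R n]
    (fun x => ((ComplexField.Normc.normc (f x) / l) `^ q x)%:E).
Proof.
move=> mq [fr fi]; apply/measurable_EFinP; apply: (measurable_powR2 _ mq).
apply: measurable_funM; last exact: measurable_cst.
rewrite (_ : (fun x => ComplexField.Normc.normc _) =
    (fun x => Num.sqrt (complex.Re (f x) ^+ 2 + complex.Im (f x) ^+ 2))).
  apply: (measurableT_comp (f := @Num.sqrt R)).
    apply: continuous_measurable_fun; exact: sqrt_continuous.
  by apply: measurable_funD; exact: measurable_funX.
by apply/funext => x; case: (f x).
Qed.

Lemma normc_ge0 (z : R[i]) : 0 <= ComplexField.Normc.normc z.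
Proof. by case: z => a b; exact: sqrtr_ge0. Qed.

Lemma Lq_norm_ge0 q f : (0 <= Lq_norm q f)%E.
Proof. by apply: le_ereal_inf_tmp => _ [l [l0 _] <-]; rewrite lee_fin ltW. Qed.

(** Measurability of f and g is what makes the integral of the convex combination
    of their modulars additive. *)
Lemma Lq_norm_triangle q f g : measurable_fun [set: Leb R n] q ->
  (forall x, 1 <= q x) ->
  complex_measurable [set: Leb R n] f -> complex_measurable [set: Leb R n] g ->
  (Lq_norm q (fun x => (f x + g x)%R) <= Lq_norm q f + Lq_norm q g)%E.
Proof.
move=> mq q1 mf mg.
have [->|Foo] := eqVneq (Lq_norm q f) +oo%E.
  by rewrite addye ?leey// gt_eqF// (lt_le_trans _ (Lq_norm_ge0 _ _)).
have [->|Goo] := eqVneq (Lq_norm q g) +oo%E.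
  by rewrite addey ?leey// gt_eqF// (lt_le_trans _ (Lq_norm_ge0 _ _)).
have Ffin : Lq_norm q f \is a fin_num.
  by rewrite ge0_fin_numE ?Lq_norm_ge0// lt_neqAle Foo leey.
have Gfin : Lq_norm q g \is a fin_num.
  by rewrite ge0_fin_numE ?Lq_norm_ge0// lt_neqAle Goo leey.
apply/lee_addgt0Pr => e e0; have e20 : 0 < e / 2 by rewrite divr_gt0.
have [_ [l [l0 fl] <-] lF] := lb_ereal_inf_adherent e20 Ffin.
have [_ [m [m0 gm] <-] mG] := lb_ereal_inf_adherent e20 Gfin.
have lm0 : 0 < l + m by rewrite addr_gt0.
apply: (@le_trans _ _ (l + m)%:E); last first.
  rewrite (splitr e) [(e / 2 + e / 2)%:E]EFinD addeACA [leLHS]EFinD.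
  by apply: leeD; [exact: (ltW lF)|exact: (ltW mG)].
apply: ereal_inf_lbound; exists (l + m); last exact: erefl.
split; first exact: lm0.
apply: (integral_convex_le _ _ _ _ _ _ _ _ _ _ fl gm).
- exact: (divr_ge0 (ltW l0) (ltW lm0)).
- exact: (divr_ge0 (ltW m0) (ltW lm0)).
- by rewrite -mulrDl divff// gt_eqF.
- exact: (measurable_modular _ mq mf).
- exact: (measurable_modular _ mq mg).
- exact: (measurable_modular _ mq (complex_measurableD mf mg)).
- by move=> x; exact: powR_ge0.
- by move=> x; exact: powR_ge0.
- by move=> x; exact: powR_ge0.
- move=> x; apply: powR_add_div_le => //; [exact: normc_ge0..|].
  exact: (@le_normcD R).
Qed.

End VariableLebesgue.

(** * The annuli of a dilation *)

Section Annuli.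
Variables (R : realType) (n : nat) (A P : 'M[R]_n.+1).

(** A singular matrix has the eigenvalue 0, of modulus less than 1. *)
Lemma dilation_unitmx : dilation A -> A \in unitmx.
Proof.
move=> A_dilation; rewrite unitmxE unitfE; apply/negP => /eqP detA0.
have /det0P[v v0 vA] : \det (map_mx (real_complex R) A) == 0.
  by rewrite det_map_mx detA0 rmorph0.
have /A_dilation : eigenvalue (map_mx (real_complex R) A) 0.
  by apply/eigenvalueP; exists v => //; rewrite vA scale0r.
by rewrite normr0 ltr10.
Qed.

Lemma dilated_ballE (k : int) : dilation A ->
  dilated_ball A P k = [set x | euclidean_norm ((P *m A ^ (- k)) *m x) < 1].
Proof.
move=> /dilation_unitmx uA.
have Ak j : A ^ j *m A ^ (- j) = 1%:M.
  by rewrite -[LHS]/(A ^ j * A ^ (- j)) -(exprzDr uA) subrr.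
apply/seteqP; split => [_ [x Px <-]|x Px] /=.
  by rewrite mulmxA -(mulmxA P) -{2}(opprK k) Ak mulmx1.
exists (A ^ (- k) *m x); last by rewrite mulmxA Ak mul1mx.
by rewrite /ellipsoid/= mulmxA.
Qed.

Lemma measurable_annulus (k : int) :
  dilation A -> measurable (annulus A P k : set (Leb R n)).
Proof.
move=> dA; apply: measurableD; rewrite dilated_ballE//;
  exact: measurable_linear_ball.
Qed.

Lemma annulus0 (k : int) : dilation A -> ~ annulus A P k 0.
Proof.
move=> dA [_]; apply; rewrite dilated_ballE//= mulmx0 /euclidean_norm.
by rewrite big1 ?sqrtr0// => i _; rewrite mxE expr0n.
Qed.

End Annuli.

(** * The grand Herz-Morrey norm *)

Theorem theorem4p2 (R : realType) (n : nat) (A P : 'M[R]_n.+1) (r : R)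
    (alpha q : 'cV[R]_n.+1 -> R) (lambda theta p : R)
    (f g : 'cV[R]_n.+1 -> R[i])
    (A_dilation : dilation A) (P_ellipsoid : admissible_ellipsoid A P r)
    (theta_gt0 : 0 < theta)
    (alpha_Loo : (alpha : Leb R n -> R) \in Lfun (lebesgue R n) +oo%E)
    (alpha_origin : log_holder_origin alpha)
    (alpha_infinity : log_holder_infinity alpha)
    (q_exponent : variable_exponent q)
    (p_gt1 : 1 < p) (lambda_ge0 : 0 <= lambda)
    (f_in : grand_herz_morrey A P alpha q lambda theta p f)
    (g_in : grand_herz_morrey A P alpha q lambda theta p g) :
  grand_herz_morrey A P alpha q lambda theta p (f \+ g) /\
  (grand_herz_morrey_norm A P alpha q lambda theta p (f \+ g)%R <=
     grand_herz_morrey_norm A P alpha q lambda theta p f +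
     grand_herz_morrey_norm A P alpha q lambda theta p g)%E.
Proof.
have [[[mf f_loc] f_fin] [[mg g_loc] g_fin]] := (f_in, g_in).
have [mq q1 _ _] := q_exponent.
have malpha : measurable_fun [set: Leb R n] alpha.
  exact: (set_mem (sub_Lfun_mfun alpha_Loo)).
(* Both the norm and the local integrability condition cut f off by a factor u
   that vanishes at the origin. *)
have Lq_add (u : 'cV[R]_n.+1 -> R) : measurable_fun [set: Leb R n] u -> u 0 = 0 ->
    (Lq_norm q (fun x => (u x)%:C%C * (f x + g x))%R <=
     Lq_norm q (fun x => (u x)%:C%C * f x)%R +
     Lq_norm q (fun x => (u x)%:C%C * g x)%R)%E.
  move=> mu u0.
  rewrite (_ : (fun x => _) = (fun x => (u x)%:C%C * f x + (u x)%:C%C * g x)%R).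
    apply: (Lq_norm_triangle mq q1).
      exact: (complex_measurableZ mu u0 mf).
    exact: (complex_measurableZ mu u0 mg).
  by apply/funext => x; rewrite mulrDr.
have triangle : (grand_herz_morrey_norm A P alpha q lambda theta p (f \+ g)%R <=
     grand_herz_morrey_norm A P alpha q lambda theta p f +
     grand_herz_morrey_norm A P alpha q lambda theta p g)%E.
  apply: ge_ereal_sup => _ [e e0 <-]; apply: ge_ereal_sup => _ [L _ <-].
  have s1 : 1 <= p * (1 + e).
    apply: (le_trans (ltW p_gt1)); apply: ler_peMr.
      exact: ltW (lt_trans ltr01 p_gt1).
    by rewrite lerDl; exact: (ltW e0).
  set w := (`|\det A| `^ _)%:E; set E := (e `^ theta)%:E.
  pose a (h : 'cV[R]_n.+1 -> R[i]) (k : int) := Lq_norm q (fun x =>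
    ((`|\det A| `^ (k%:~R * alpha x) * \1_(annulus A P k) x)%:C%C * h x)%R).
  pose S h := (\esum_(k in [set k : int | (k <= L)%R]) a h k `^ (p * (1 + e)))%E.
  (* The term of index (e, L) is bounded by the supremum. *)
  have le_norm h : (w * (E * S h) `^ (p * (1 + e))^-1 <=
      grand_herz_morrey_norm A P alpha q lambda theta p h)%E.
    apply: ereal_sup_ge; eexists; first by exists e.
    by apply: ereal_sup_ubound; exists L.
  have E0 : (0 <= E)%E by rewrite lee_fin powR_ge0.
  have w0 : (0 <= w)%E by rewrite lee_fin powR_ge0.
  have S0 h : (0 <= S h)%E by apply: esum_ge0 => k _; exact: poweR_ge0.
  apply: le_trans (leeD (le_norm f) (le_norm g)).
  suff : (S (fun x => f x + g x)%R `^ (p * (1 + e))^-1 <=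
      S f `^ (p * (1 + e))^-1 + S g `^ (p * (1 + e))^-1)%E.
    exact: (weighted_poweR_add_le w0 E0 (S0 _) (S0 f) (S0 g)).
  apply: (esum_minkowski s1) => k _; [exact: Lq_norm_ge0..|].
  rewrite Lq_norm_ge0/=; apply: Lq_add.
    apply: measurable_funM; last first.
      by apply: measurable_indic; exact: (measurable_annulus P k A_dilation).
    apply: measurable_powR2; first exact: measurable_cst.
    by apply: measurable_funM; [exact: measurable_cst|exact: malpha].
  by rewrite indicE memNset ?mulr0//; exact: annulus0.
split; last exact: triangle.
split; last exact: (le_lt_trans triangle (lte_add_pinfty f_fin g_fin)).
split; first exact: (complex_measurableD mf mg).
move=> K cK K0.
have mK : measurable_fun [set: Leb R n] (\1_K : Leb R n -> R).
  apply: measurable_indic; apply: measurable_closed.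
  exact: (compact_closed (@norm_hausdorff R 'cV[R]_n.+1) cK).
have K00 : \1_K (0 : 'cV[R]_n.+1) = 0 :> R.
  by rewrite indicE memNset// => /K0; exact.
apply: (le_lt_trans (Lq_add _ mK K00)).
exact: (lte_add_pinfty (f_loc _ cK K0) (g_loc _ cK K0)).
Qed.
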